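(* Let $F$ be an algebraically closed field of characteristic $0$ and $k\ge1$. Let $h:\mathbb{F}_2^{2k+1}\to\mathbb{F}_2$, $h(a)=\sum_{i=1}^k a_{2i-1}a_{2i}+a_{2k+1}^2$, let $\beta_1(a,b)=h(a+b)-h(a)-h(b)$ be its polarization, let $G=\mathbb{Z}_2^{2k+1}$ (identified with the additive group of $\mathbb{F}_2^{2k+1}$), and let $\beta:G\times G\to F^\times$, $\beta(a,b)=(-1)^{\beta_1(a,b)}$ (so $\mathrm{Rad}(\beta)=\{0,e_{2k+1}\}$). (1) The subset $R^+=\{a\in G\mid h(a)=0\}$ is a skew root system of Jordan type in $(G,\beta)$. (2) The corresponding reduced skew root system of $R^+$ is $\mathbb{Z}_2^{2k}$ in the nonsingular symplectic abelian group $(\mathbb{Z}_2^{2k},\overline\beta)$, where $\overline\beta(a,b)=(-1)^{\sum_{i=1}^k(a_{2i}b_{2i-1}-a_{2i-1}b_{2i})}$. Moreover $R^+$ is nonreduced and indecomposable, $|R^+|=2^{2k}$, and $J(R^+)$ is isomorphic to $M(2^k,F)^+$.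
   Context: An alternating bicharacter on an abelian group $G$ is a $\mathbb{Z}$-bilinear map $\beta:G\times G\to F^\times$ with $\beta(g,g)=1$ for all $g$; then $(G,\beta)$ is a symplectic abelian group, $\mathrm{Rad}(\beta)=\{g\in G:\beta(g,h)=1\ \forall h\in G\}$, and $(G,\beta)$ is nonsingular if $\mathrm{Rad}(\beta)=0$. A nonempty $R\subseteq G$ is a skew root system of Jordan type in $(G,\beta)$ if: $R$ generates $G$; $R=-R$; and $a,b\in R$, $\beta(a,b)\neq-1$ imply $a+b\in R$. It is reduced if $\mathrm{Rad}(\beta)=0$. Its graph has vertex set $R$ and an edge $\{a,b\}$ for distinct $a,b\in R$ whenever $\beta(a,b)\ne-1$; by convention every skew root system of Jordan type is called indecomposable, as this graph is connected. The corresponding reduced skew root system of $(G,\beta,R)$ is $(\overline G,\overline\beta,\overline R)$, where $\overline G=G/\mathrm{Rad}(\beta)$, $\overline\beta$ is the bicharacter on $\overline G$ induced by $\beta$, and $\overline R$ is the image of $R$; here $\overline G$ is identified with $\mathbb{Z}_2^{2k}$ via $(a_1,\dots,a_{2k+1})\mapsto(a_1,\dots,a_{2k})$. Choose a 2-cocycle $\xi\in Z^2(G,F^\times)$ with $\xi(a,b)\xi(b,a)^{-1}=\beta(a,b)$ (it exists; different choices give isomorphic graded algebras), and let $F^\xi G$ be the associative algebra with basis $\{u_g:g\in G\}$ and $u_au_b=\xi(a,b)u_{a+b}$. Then $J(R)=\bigoplus_{a\in R}Fu_a$ with $x\circ y=\frac12(xy+yx)$. For an associative algebra $A$, $A^+$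 denotes $A$ with Jordan product $x\circ y=\frac12(xy+yx)$; $M(m,F)$ is the algebra of $m\times m$ matrices. *)

(* Defs.v *)
From HB Require Import structures.
From mathcomp Require Import all_boot all_order all_fingroup all_algebra.
From mathcomp Require Import ring.

Set Implicit Arguments.
Unset Strict Implicit.
Unset Printing Implicit Defensive.

Import GRing.Theory.
Local Open Scope ring_scope.
Local Open Scope quotient_scope.

Section Bicharacter.
Variables (F : fieldType) (G : finZmodType).

(* [F^x] is rendered as the nonzero elements of [F]. *)
Definition is_alt_bicharacter (beta : G -> G -> F) : Prop :=
  [/\ forall a b, beta a b != 0,
      forall a b c, beta (a + b) c = beta a c * beta b c,
      forall a b c, beta a (b + c) = beta a b * beta a c
    & forall a, beta a a = 1].

Record alt_bicharacter := AltBicharacter {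
  bichar :> G -> G -> F;
  bicharP : is_alt_bicharacter bichar
}.

Variable beta : alt_bicharacter.

Definition bichar_rad : {set G} := [set g | [forall h, beta g h == 1]].

Definition nonsingular : Prop := bichar_rad = [set 0].

(* Reducedness of a skew root system [R] depends only on its bicharacter. *)
Definition reduced (R : {set G}) : Prop := nonsingular.

Variable R : {set G}.

(* The group law of the finite group [G] is its addition, so [<<R>>%g] is the
   additive subgroup generated by [R]. *)
Definition skew_root_system : Prop :=
  [/\ R != set0,
      <<R>>%g = [set: G],
      [set - a | a in R] = R
    & {in R &, forall a b, beta a b != -1 -> a + b \in R}].

Definition srs_edge : rel G :=
  fun a b => [&& a \in R, b \in R, a != b & beta a b != -1].

Definition indecomposable : Prop := {in R &, forall a b, connect srs_edge a b}.

Lemma bichar_neq0 a b : beta a b != 0.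
Proof. by case: (bicharP beta). Qed.

Lemma bicharDl a b c : beta (a + b) c = beta a c * beta b c.
Proof. by case: (bicharP beta). Qed.

Lemma bicharDr a b c : beta a (b + c) = beta a b * beta a c.
Proof. by case: (bicharP beta). Qed.

Lemma bicharxx a : beta a a = 1.
Proof. by case: (bicharP beta). Qed.

Lemma bichar0l b : beta 0 b = 1.
Proof.
by apply: (mulfI (bichar_neq0 0 b)); rewrite -bicharDl addr0 mulr1.
Qed.

Lemma bicharNl a b : beta (- a) b = (beta a b)^-1.
Proof.
by apply: (mulfI (bichar_neq0 a b)); rewrite -bicharDl subrr bichar0l mulfV
  ?bichar_neq0.
Qed.

Lemma bicharC a b : beta a b = (beta b a)^-1.
Proof.
apply: (mulIf (bichar_neq0 b a)); rewrite mulVf ?bichar_neq0 //.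
by have := bicharxx (a + b); rewrite bicharDl !bicharDr !bicharxx mul1r mulr1.
Qed.

Lemma in_bichar_radP g : reflect (forall h, beta g h = 1) (g \in bichar_rad).
Proof. by rewrite inE; apply: (iffP forallP) => H h; apply/eqP/H. Qed.

End Bicharacter.

Section Quotient.
Variables (F : fieldType) (G : finZmodType) (beta : alt_bicharacter F G).

Definition rad_pred : {pred G} := fun g => g \in bichar_rad beta.

Fact rad_zmod_closed : zmod_closed rad_pred.
Proof.
split=> [|x y]; rewrite !unfold_in; first by apply/in_bichar_radP => h; rewrite bichar0l.
move=> /in_bichar_radP Hx /in_bichar_radP Hy; apply/in_bichar_radP => h.
by rewrite bicharDl bicharNl Hx Hy invr1 mulr1.
Qed.

HB.instance Definition _ := GRing.isZmodClosed.Build G rad_pred rad_zmod_closed.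

Definition quo : Type := Quotient.quot rad_pred.
HB.instance Definition _ := GRing.Zmodule.on quo.
HB.instance Definition _ := EqQuotient.on quo.
HB.instance Definition _ : isCountable quo :=
  CanIsCountable (reprK : cancel (generic_quotient.repr : quo -> G) \pi_quo).
HB.instance Definition _ : isFinite quo :=
  CanIsFinite (reprK : cancel (generic_quotient.repr : quo -> G) \pi_quo).

(* The value does not depend on the representatives: see [quo_formE]. *)
Definition quo_form (x y : quo) : F :=
  beta (generic_quotient.repr x) (generic_quotient.repr y).

Lemma quo_formE a b : quo_form (\pi_quo a) (\pi_quo b) = beta a b.
Proof.
have radl c d e : c == d %[mod quo] -> beta c e = beta d e.
  rewrite -Quotient.idealrBE unfold_in => /in_bichar_radP/(_ e) cd.
  by rewrite -(subrK d c) bicharDl cd mul1r.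
rewrite /quo_form (radl _ a) ?reprK // bicharC (radl _ b) ?reprK //.
by rewrite -bicharC.
Qed.

Fact quo_formP : is_alt_bicharacter quo_form.
Proof.
split=> [x y|x y z|x y z|x]; first exact: bichar_neq0.
- rewrite -[x]reprK -[y]reprK -[z]reprK -raddfD !quo_formE; exact: bicharDl.
- rewrite -[x]reprK -[y]reprK -[z]reprK -raddfD !quo_formE; exact: bicharDr.
- exact: bicharxx.
Qed.

Definition quo_bichar : alt_bicharacter F quo := AltBicharacter quo_formP.

Definition quo_roots (R : {set G}) : {set quo} := [set \pi_quo a | a in R].

End Quotient.

Definition srs_iso (F : fieldType) (G H : finZmodType)
    (beta : alt_bicharacter F G) (R : {set G})
    (gamma : alt_bicharacter F H) (S : {set H}) (phi : G -> H) : Prop :=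
  [/\ {morph phi : a b / a + b},
      bijective phi,
      forall a b, gamma (phi a) (phi b) = beta a b
    & [set phi a | a in R] = S].

Section TwistedGroupAlgebra.
Variables (F : fieldType) (G : finZmodType).

Definition is_cocycle (xi : G -> G -> F) : Prop :=
  (forall a b, xi a b != 0) /\
  (forall a b c, xi a b * xi (a + b) c = xi b c * xi a (b + c)).

Definition cocycle_of (beta : G -> G -> F) (xi : G -> G -> F) : Prop :=
  is_cocycle xi /\ forall a b, xi a b * (xi b a)^-1 = beta a b.

Definition twalg : vectType F := {ffun G -> F^o}.

Definition twbasis (g : G) : twalg := [ffun a => (a == g)%:R].

Variable xi : G -> G -> F.

Definition twmul (x y : twalg) : twalg :=
  \sum_a \sum_b (x a * y b * xi a b) *: twbasis (a + b).

Lemma twmul_basis a b :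
  twmul (twbasis a) (twbasis b) = xi a b *: twbasis (a + b).
Proof.
rewrite /twmul (bigD1 a) //= [X in _ + X]big1 ?addr0 => [|c /negPf ca].
  rewrite (bigD1 b) //= [X in _ + X]big1 ?addr0 => [|d /negPf db].
    by rewrite !ffunE !eqxx !mul1r.
  by rewrite !ffunE db mulr0 mul0r scale0r.
by rewrite big1 // => d _; rewrite !ffunE ca !mul0r scale0r.
Qed.

Definition jordan_space (R : {set G}) : {vspace twalg} :=
  (\sum_(a in R) <[twbasis a]>)%VS.

End TwistedGroupAlgebra.

Definition jordan_prod (F : fieldType) (A : lmodType F) (mul : A -> A -> A)
    (x y : A) : A :=
  2%:R^-1 *: (mul x y + mul y x).

(* [U], a subspace of [A] closed under the product [mulA], is isomorphic to
   [(B, mulB)].  As in [kHom], the isomorphism is represented by a linear map on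
   the ambient space, of which only the restriction to [U] matters. *)
Definition subalg_isomorphic (F : fieldType) (A B : vectType F)
    (mulA : A -> A -> A) (U : {vspace A}) (mulB : B -> B -> B) : Prop :=
  {in U &, forall x y, mulA x y \in U} /\
  exists f : 'Hom(A, B),
    [/\ {in U &, injective f},
        (f @: U)%VS = fullv
      & {in U &, {morph f : x y / mulA x y >-> mulB x y}}].

Section Example.

Definition Z2pow (n : nat) : finZmodType := 'rV['F_2]_n.

Variables (F : fieldType) (k : nat).

Fact odd_coord_subproof (i : 'I_k) : (2 * i < 2 * k)%N.
Proof. by rewrite ltn_mul2l ltn_ord. Qed.

Fact even_coord_subproof (i : 'I_k) : ((2 * i).+1 < 2 * k)%N.
Proof. by rewrite !mul2n ltn_Sdouble. Qed.

(* With [i] counted from [0], these are the positions of the coordinates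
   [2i + 1] and [2i + 2] of the usual numbering from [1]. *)
Definition odd_coord (i : 'I_k) : 'I_(2 * k) := Ordinal (odd_coord_subproof i).
Definition even_coord (i : 'I_k) : 'I_(2 * k) := Ordinal (even_coord_subproof i).

Definition last_coord : 'I_(2 * k + 1) := rshift (2 * k) ord0.

Definition quad_form (a : Z2pow (2 * k + 1)) : 'F_2 :=
  \sum_(i < k) a 0 (lshift 1 (odd_coord i)) * a 0 (lshift 1 (even_coord i))
  + a 0 last_coord ^+ 2.

Definition polar_form (a b : Z2pow (2 * k + 1)) : 'F_2 :=
  quad_form (a + b) - quad_form a - quad_form b.

(* The exponent is the representative, [0] or [1], of an element of ['F_2]. *)
Definition sign_form (x : 'F_2) : F := (-1) ^+ (x : nat).

Definition bar_form (a b : Z2pow (2 * k)) : 'F_2 :=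
  \sum_(i < k) (a 0 (even_coord i) * b 0 (odd_coord i)
                - a 0 (odd_coord i) * b 0 (even_coord i)).

Lemma sign_formD x y : sign_form (x + y) = sign_form x * sign_form y.
Proof.
rewrite /sign_form -exprD.
case: x => [[|[|]]] // ?; case: y => [[|[|]]] // ?.
by rewrite /= (expr2 (-1)) mulrNN mulr1.
Qed.

Lemma oppr_F2 (x : 'F_2) : - x = x.
Proof. by apply/eqP; case: x => [[|[|]]]. Qed.

Lemma bar_formDl a b c : bar_form (a + b) c = bar_form a c + bar_form b c.
Proof.
by rewrite /bar_form -big_split; apply: eq_bigr => i _; rewrite !mxE /=; ring.
Qed.

Lemma bar_formDr a b c : bar_form a (b + c) = bar_form a b + bar_form a c.
Proof.
by rewrite /bar_form -big_split; apply: eq_bigr => i _; rewrite !mxE /=; ring.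
Qed.

Lemma bar_formxx a : bar_form a a = 0.
Proof. by rewrite /bar_form big1 // => i _; rewrite mulrC subrr. Qed.

Lemma polar_formE a b :
  polar_form a b = bar_form (lsubmx a) (lsubmx b).
Proof.
rewrite /polar_form /quad_form /bar_form.
set z := a 0 last_coord; set z' := b 0 last_coord.
have -> : (a + b) 0 last_coord ^+ 2 = z ^+ 2 + z' ^+ 2.
  rewrite mxE -/z -/z' sqrrD -[RHS]addr0 addrAC; congr (_ + _).
  by rewrite mulr2n -[X in X + _]oppr_F2 addNr.
rewrite (eq_bigr (fun i : 'I_k =>
    a 0 (lshift 1 (odd_coord i)) * a 0 (lshift 1 (even_coord i))
  + b 0 (lshift 1 (odd_coord i)) * b 0 (lshift 1 (even_coord i))
  + (lsubmx a 0 (even_coord i) * lsubmx b 0 (odd_coord i)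
     - lsubmx a 0 (odd_coord i) * lsubmx b 0 (even_coord i)))).
  by rewrite !big_split /=; ring.
by move=> i _; rewrite -mulNr !oppr_F2 !mxE; ring.
Qed.

Fact bar_sign_formP : is_alt_bicharacter (fun a b => sign_form (bar_form a b)).
Proof.
split=> [a b|a b c|a b c|a]; first by rewrite /sign_form signr_eq0.
- by rewrite bar_formDl sign_formD.
- by rewrite bar_formDr sign_formD.
- by rewrite bar_formxx.
Qed.

Definition bar_bichar : alt_bicharacter F (Z2pow (2 * k)) :=
  AltBicharacter bar_sign_formP.

Fact sign_formP : is_alt_bicharacter (fun a b => sign_form (polar_form a b)).
Proof.
split=> [a b|a b c|a b c|a]; first by rewrite /sign_form signr_eq0.
- by rewrite !polar_formE raddfD bar_formDl sign_formD.
- by rewrite !polar_formE raddfD bar_formDr sign_formD.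
- by rewrite polar_formE bar_formxx.
Qed.

Definition polar_bichar : alt_bicharacter F (Z2pow (2 * k + 1)) :=
  AltBicharacter sign_formP.

Definition Rplus : {set Z2pow (2 * k + 1)} := [set a | quad_form a == 0].

Definition e_last : Z2pow (2 * k + 1) := delta_mx 0 last_coord.

End Example.

(* Main.v *)
Require Import Defs.
From HB Require Import structures.
From mathcomp Require Import all_boot all_order all_fingroup all_algebra.
From mathcomp Require Import ring.

Set Implicit Arguments.
Unset Strict Implicit.
Unset Printing Implicit Defensive.

Import GRing.Theory.
Local Open Scope ring_scope.
Local Open Scope quotient_scope.

(** The radical of beta is the line spanned by e = e_last, and
h(a + e) = h(a) + 1. So every coset of the radical meets R+ in exactly one point: the
projection lsubmx, which forgets the last coordinate, restricts to a bijection
from R+ onto Z_2^2k, with inverse Rplus_lift. This gives the cardinality and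
the reduced root system. Closure holds because h(a + b) = beta_1(a, b) for a, b
in R+, so beta(a, b) is 1 exactly when a + b is in R+. Since beta_1 is not zero
for k > 0, some sum a + b leaves R+; then a + b + e is back in R+, so e is a
sum of roots and R+ generates G. As 0 is a root adjacent to all the others, the
graph is connected.

For the algebra, the twisted group algebra of G modulo a central character is
the twisted group algebra of the nonsingular quotient, hence a matrix algebra,
and J(R+) is mapped isomorphically because R+ is a transversal of the radical.
This is made concrete by projective representations, that is, families X of
matrices with X_a X_b = xi(a, b) X_(a+b).

- For one particular cocycle, the sign of half_form, a projective
  representation on functions on F_2^k is given by the Pauli matrices, products
  of a translation by the odd coordinates and a sign character given by the
  even ones (pauli_mxM).
- An arbitrary cocycle xi with the same commutation factor beta differs from it
  by a symmetric cocycle. Over an algebraically closed field symmetric cocycles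
  are coboundaries (symmetric_cocycle_coboundary), so rescaling the Pauli
  matrices yields a projective representation for xi (exists_proj_rep).
- In any projective representation the trace of X_a vanishes for a outside the
  radical (trace_proj_rep). So the trace form recovers the coefficients of an
  element of J(R) from its image as soon as distinct elements of R are distinct
  modulo the radical. The map is then injective on J(R), and onto when #|R| is
  the square of the degree (jordan_space_iso_matrix). *)

(** * Common eigenvectors of commuting matrices *)

Section CommonEigenvector.
Variables (F : closedFieldType) (n : nat).
Implicit Types (A B : 'M[F]_n.+1) (v : 'rV[F]_n.+1).

(** The characteristic polynomial splits and kills v. Multiplying v by its
linear factors one at a time, the last nonzero vector met is an eigenvector. It
has the form v q(A), and so it stays an eigenvector of whatever commutes with A
and already has v as an eigenvector. *)
Lemma exists_eigenvector_horner A v : v != 0 ->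
  exists q : {poly F}, exists r : F,
    v *m horner_mx A q != 0 /\
    v *m horner_mx A q *m A = r *: (v *m horner_mx A q).
Proof.
move=> v_neq0.
have [s def_p] := closed_field_poly_normal (char_poly A).
have: v *m horner_mx A (\prod_(z <- s) ('X - z%:P)) = 0.
  have := Cayley_Hamilton A; rewrite def_p (monicP (char_poly_monic A)) scale1r.
  by move=> ->; rewrite mulmx0.
elim: s {def_p} => [|r s IHs].
  by rewrite big_nil rmorph1 mulmx1 => /eqP; rewrite (negPf v_neq0).
set q := \prod_(z <- s) _ in IHs *; rewrite big_cons -/q mulrC => vq.
have [/IHs //|vq_neq0] := eqVneq (v *m horner_mx A q) 0.
exists q, r; split=> //; apply/eqP; rewrite -subr_eq0 -mul_mx_scalar -mulmxBr.
by rewrite -[X in X - _](horner_mx_X A) -(horner_mx_C A) -rmorphB -mulmxA mulmxE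
   -rmorphM /= vq.
Qed.

Lemma common_eigenvector_seq (As : seq 'M[F]_n.+1) :
  {in As &, forall A B, comm_mx A B} ->
  exists2 v : 'rV[F]_n.+1, v != 0 &
    {in As, forall A, exists r : F, v *m A = r *: v}.
Proof.
elim: As => [_|A As IHs cAs].
  exists (const_mx 1) => //.
  by apply/eqP=> /rowP/(_ 0)/eqP; rewrite !mxE oner_eq0.
have [|v v_neq0 vAs] := IHs.
  by move=> B C BA CA; apply: cAs; rewrite inE (BA, CA) orbT.
have [q [r [vq_neq0 vqA]]] := exists_eigenvector_horner A v_neq0.
exists (v *m horner_mx A q) => // B; rewrite inE => /predU1P[->|BAs].
  by exists r.
have [t vB] := vAs B BAs; exists t.
have cBA : comm_mx B A by apply: cAs; rewrite inE ?BAs ?eqxx ?orbT.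
by rewrite -mulmxA -(comm_mx_horner _ cBA) mulmxA vB -scalemxAl.
Qed.

End CommonEigenvector.

(** * Monomial matrices *)

Lemma enumerate_bij (T : finType) n :
  #|T| = n -> exists e : 'I_n -> T, bijective e.
Proof. by move=> <-; exists enum_val; apply: enum_val_bij. Qed.

Section MonomialMatrix.
Variables (F : fieldType) (T : finType) (n : nat) (e : 'I_n -> T).
Hypothesis e_bij : bijective e.

(** The operator sending a function phi on T to x |-> f x * phi (s x). The
enumeration e is a parameter because both sizes needed below, 2 ^ k and a
successor, are only propositionally equal to #|T|. *)
Definition monomial_mx (f : T -> F) (s : T -> T) : 'M[F]_n :=
  \matrix_(i, j) (f (e i) * (e j == s (e i))%:R).

Lemma monomial_mxM f s g t :
  monomial_mx f s *m monomial_mx g t =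
    monomial_mx (fun x => f x * g (s x)) (t \o s).
Proof.
have [e' e'K eK] := e_bij.
apply/matrixP=> i j; rewrite !mxE (bigD1 (e' (s (e i)))) //= !mxE eK eqxx mulr1.
rewrite big1 ?addr0 ?mulrA // => l ne_l.
by rewrite !mxE (can2_eq e'K eK) (negPf ne_l) mulr0 mul0r.
Qed.

Lemma eq_monomial_mx f g s t :
  f =1 g -> s =1 t -> monomial_mx f s = monomial_mx g t.
Proof. by move=> fg st; apply/matrixP=> i j; rewrite !mxE fg st. Qed.

Lemma monomial_mxZ c f s :
  monomial_mx (fun x => c * f x) s = c *: monomial_mx f s.
Proof. by apply/matrixP=> i j; rewrite !mxE mulrA. Qed.

Lemma monomial_mx_scalar c : monomial_mx (fun=> c) id = c%:M.
Proof.
by apply/matrixP=> i j; rewrite !mxE (bij_eq e_bij) eq_sym mulr_natr.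
Qed.

End MonomialMatrix.

(** * Symmetric cocycles are coboundaries *)

Section Coboundary.
Variables (F : closedFieldType) (G : finZmodType) (tau : G -> G -> F).
Hypothesis tau_cocycle : is_cocycle tau.
Hypothesis tau_sym : forall a b, tau a b = tau b a.

Lemma cocycle0l a : tau 0 a = tau 0 0.
Proof.
have [nz cc] := tau_cocycle.
by have := cc 0 0 a; rewrite !add0r => /(mulIf (nz _ _)).
Qed.

(** For symmetric tau the twisted group algebra is commutative, so the
operators L_g of its regular representation have a common eigenvector; the
eigenvalue l_g of L_g defines a character of the algebra, which trivializes
tau. *)
Lemma symmetric_cocycle_coboundary :
  exists2 l : G -> F, forall a, l a != 0 &
    forall a b, l a * l b = tau a b * l (a + b).
Proof.
have [nz cc] := tau_cocycle.
have [|e e_bij] := @enumerate_bij G #|G|.-1.+1.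
  by rewrite prednK //; apply/card_gt0P; exists 0.
pose L g := monomial_mx e (tau g) (+%R g).
have LM g h : L g *m L h = tau g h *: L (g + h).
  rewrite monomial_mxM // -monomial_mxZ; apply: eq_monomial_mx => x /=.
    by rewrite [tau g h]tau_sym [g + h]addrC cc.
  by rewrite addrCA addrA.
have L0 : L 0 = (tau 0 0)%:M.
  rewrite -(monomial_mx_scalar e_bij); apply: eq_monomial_mx => x.
    exact: cocycle0l.
  exact: add0r.
have [|v v_neq0 vL] := @common_eigenvector_seq _ _ [seq L g | g : G].
  move=> _ _ /imageP[g _ ->] /imageP[h _ ->].
  by rewrite /comm_mx !LM tau_sym addrC.
have /fin_all_exists[l vl] g : exists r, v *m L g = r *: v.
  by apply: vL; apply: image_f.
have scale_inj c d : c *: v = d *: v -> c = d.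
  move/eqP; rewrite -subr_eq0 -scalerBl scaler_eq0 (negPf v_neq0) orbF.
  by rewrite subr_eq0 => /eqP.
have lM a b : l a * l b = tau a b * l (a + b).
  apply: scale_inj; rewrite -!scalerA -(vl (a + b)) scalemxAr -LM mulmxA.
  by rewrite vl -scalemxAl vl !scalerA mulrC.
exists l => // a; apply/eqP=> la0.
have := lM a (- a); rewrite la0 mul0r subrr => /esym/eqP.
rewrite mulf_eq0 (negPf (nz _ _)) /=.
suff -> : l 0 = tau 0 0 by rewrite (negPf (nz _ _)).
by apply: scale_inj; rewrite -vl L0 mul_mx_scalar.
Qed.

End Coboundary.

(** * The Jordan algebra of a skew root system *)

Section JordanSpace.
Variables (F : fieldType) (G : finZmodType) (R : {set G}).

Lemma scale_twbasisE (c : F) (g a : G) :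
  (c *: twbasis F g) a = c * (a == g)%:R :> F.
Proof. by rewrite !ffunE. Qed.

Lemma mem_jordan_space (x : twalg F G) :
  reflect (forall a, a \notin R -> x a = 0) (x \in jordan_space F R).
Proof.
apply: (iffP idP) => [/memv_sumP[y yR ->] a aR|xR].
  rewrite sum_ffunE big1 // => b bR; have /vlineP[c ->] := yR b bR.
  by rewrite scale_twbasisE; case: eqP aR => [->|_ _]; rewrite ?bR ?mulr0.
have -> : x = \sum_(a in R) x a *: twbasis F a.
  apply/ffunP=> a; rewrite sum_ffunE.
  have [aR|aR] := boolP (a \in R).
    rewrite (bigD1 a) //= big1 ?addr0 => [|b /andP[_ /negPf ba]].
      by rewrite scale_twbasisE eqxx mulr1.
    by rewrite scale_twbasisE eq_sym ba mulr0.
  rewrite xR // big1 // => b bR; rewrite scale_twbasisE.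
  by case: eqP aR => [->|_ _]; rewrite ?bR ?mulr0.
by apply: memv_sumr => a aR; apply/memvZ/memv_line.
Qed.

Lemma dim_jordan_space : \dim (jordan_space F R) = #|R|.
Proof.
have /directvP/= -> : directv (\sum_(a in R) <[twbasis F a]>)%VS.
  apply/directv_sum_independent => us usP us0 a aR.
  have /vlineP[c def_us] := usP a aR.
  have := congr1 (fun x : twalg F G => x a) us0.
  rewrite sum_ffunE (bigD1 a) //= big1 ?addr0 => [|b /andP[bR /negPf ba]].
    by rewrite def_us scale_twbasisE eqxx mulr1 ffunE => ->; rewrite scale0r.
  by have /vlineP[c' ->] := usP b bR; rewrite scale_twbasisE eq_sym ba mulr0.
rewrite -sum1_card; apply: eq_bigr => a _; rewrite dim_vline.
suff -> : twbasis F a != 0 by [].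
by apply/eqP=> /ffunP/(_ a)/eqP; rewrite !ffunE eqxx oner_eq0.
Qed.

Variables (beta : alt_bicharacter F G) (xi : G -> G -> F).
Hypothesis xiP : cocycle_of beta xi.

Lemma cocycle_swap a b : xi a b = beta a b * xi b a.
Proof. by case: xiP => [[nz _] <-]; rewrite mulfVK. Qed.

Lemma twmulE (x y : twalg F G) c :
  twmul xi x y c = \sum_a x a * y (c - a) * xi a (c - a).
Proof.
rewrite /twmul sum_ffunE; apply: eq_bigr => a _.
rewrite sum_ffunE (bigD1 (c - a)) //= big1 ?addr0 => [|b /negPf ne_b].
  by rewrite scale_twbasisE subrKC eqxx mulr1.
by rewrite scale_twbasisE [a + b]addrC -subr_eq eq_sym ne_b mulr0.
Qed.

Hypothesis R_closed : {in R &, forall a b, beta a b != -1 -> a + b \in R}.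

(** If a and b are in R but c = a + b is not, then beta(a, b) = -1, that is,
u_a and u_b anticommute and contribute nothing to the coefficient at c. *)
Lemma jordan_space_closed :
  {in jordan_space F R &, forall x y,
     jordan_prod (twmul xi) x y \in jordan_space F R}.
Proof.
move=> x y /mem_jordan_space xR /mem_jordan_space yR.
apply/mem_jordan_space=> c cR.
rewrite /jordan_prod !ffunE !twmulE.
(* Pair the term x_a y_(c-a) u_a u_(c-a) with y_(c-a) x_a u_(c-a) u_a. *)
rewrite [X in _ + X](reindex_inj (can_inj (subKr c))) /= -big_split.
rewrite big1 ?scaler0 //= => a _; rewrite subKr.
have [aR|/xR->] := boolP (a \in R); last by rewrite !(mul0r, mulr0) addr0.
have [caR|/yR->] := boolP (c - a \in R); last by rewrite !(mul0r, mulr0) addr0.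
have [b1|/(R_closed aR caR)] := eqVneq (beta a (c - a)) (-1); last first.
  by rewrite subrKC (negPf cR).
by rewrite cocycle_swap b1; ring.
Qed.

End JordanSpace.

(** * Projective representations and their traces *)

Section ProjectiveRepresentation.
Variables (F : fieldType) (G : finZmodType) (beta : alt_bicharacter F G).
Variables (xi : G -> G -> F) (d : nat) (X : G -> 'M[F]_d).
Hypothesis xiP : cocycle_of beta xi.
Hypothesis XM : forall a b, X a *m X b = xi a b *: X (a + b).
Hypothesis trX0 : \tr (X 0) != 0.

Let xi_neq0 a b : xi a b != 0. Proof. by case: xiP => [[]]. Qed.

(** Choose b with beta(a, b) <> 1. Moving X_b past X_a costs the factor beta(a,
b), while moving it cyclically under the trace costs nothing. *)
Lemma trace_proj_rep a : a \notin bichar_rad beta -> \tr (X a) = 0.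
Proof.
rewrite inE negb_forall => /existsP[b beta_neq1].
have XC : X a *m X b = beta a b *: (X b *m X a).
  by rewrite !XM scalerA -(cocycle_swap xiP) [b + a]addrC.
(* X_(-b) replaces the inverse of X_b: their product is a multiple of X_0. *)
have := mxtrace_mulC (X (- b)) (X a *m X b).
rewrite [in LHS]XC -scalemxAr mulmxA -[in RHS]mulmxA !XM !addNr !subrr.
rewrite -scalemxAl -scalemxAr !XM add0r addr0 !mxtraceZ.
rewrite [xi b (- b)](cocycle_swap xiP) [xi a 0](cocycle_swap xiP).
rewrite [beta b (- b)]bicharC bicharNl bicharxx !invr1 mul1r.
rewrite [beta a 0]bicharC bichar0l invr1 mul1r.
move/eqP; rewrite -subr_eq0 -[X in _ - X]mul1r -mulrBl mulf_eq0 subr_eq0.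
by rewrite (negPf beta_neq1) !mulf_eq0 !(negPf (xi_neq0 _ _)) => /eqP.
Qed.

Definition proj_rep_ext (x : twalg F G) : 'M[F]_d := \sum_a x a *: X a.

Fact proj_rep_ext_linear : linear proj_rep_ext.
Proof.
move=> c x y; rewrite /proj_rep_ext scaler_sumr -big_split /=.
by apply: eq_bigr => a _; rewrite !ffunE scalerDl scalerA.
Qed.

HB.instance Definition _ :=
  GRing.isLinear.Build F (twalg F G) 'M[F]_d *:%R proj_rep_ext
    proj_rep_ext_linear.

Lemma proj_rep_ext_basis g : proj_rep_ext (twbasis F g) = X g.
Proof.
rewrite /proj_rep_ext (bigD1 g) //= big1 ?addr0 => [|a /negPf ag].
  by rewrite ffunE eqxx scale1r.
by rewrite ffunE ag scale0r.
Qed.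

Lemma proj_rep_extM (x y : twalg F G) :
  proj_rep_ext (twmul xi x y) = proj_rep_ext x *m proj_rep_ext y.
Proof.
rewrite /twmul raddf_sum /= [proj_rep_ext x]/proj_rep_ext mulmx_suml.
apply: eq_bigr => a _; rewrite raddf_sum /= /(proj_rep_ext y) mulmx_sumr.
apply: eq_bigr => b _; rewrite linearZ /= proj_rep_ext_basis.
by rewrite -scalemxAl -scalemxAr XM !scalerA.
Qed.

Variable R : {set G}.
Hypothesis R_closed : {in R &, forall a b, beta a b != -1 -> a + b \in R}.
Hypothesis R_inj : {in R &, forall a b, a - b \in bichar_rad beta -> a = b}.

(** Only the term a = b survives: for a <> b in R, a - b is outside the radical
and trace_proj_rep applies. *)
Lemma proj_rep_ext_trace (x : twalg F G) b :
  x \in jordan_space F R -> b \in R ->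
  \tr (proj_rep_ext x *m X (- b)) = x b * (xi b (- b) * \tr (X 0)).
Proof.
move=> /mem_jordan_space xR bR; rewrite mulmx_suml raddf_sum (bigD1 b) //= big1.
  by rewrite addr0 -scalemxAl XM subrr !mxtraceZ.
move=> a ab; have [aR|/xR->] := boolP (a \in R); last first.
  by rewrite scale0r mul0mx mxtrace0.
rewrite -scalemxAl XM !mxtraceZ trace_proj_rep ?mulr0 //.
by apply: contraNN ab => /R_inj->.
Qed.

Lemma proj_rep_ext_inj (x : twalg F G) :
  x \in jordan_space F R -> proj_rep_ext x = 0 -> x = 0.
Proof.
move=> xR fx0; apply/ffunP=> b; rewrite [RHS]ffunE.
have [bR|bR] := boolP (b \in R); last exact: (mem_jordan_space _ _ xR).
have := proj_rep_ext_trace xR bR; rewrite fx0 mul0mx mxtrace0 => /esym/eqP.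
by rewrite !mulf_eq0 (negPf (xi_neq0 _ _)) (negPf trX0) !orbF => /eqP.
Qed.

Lemma jordan_space_iso_matrix : #|R| = (d * d)%N ->
  subalg_isomorphic (jordan_prod (twmul xi)) (jordan_space F R)
    (jordan_prod (@mulmx F d d d)).
Proof.
move=> cardR; split; first exact: jordan_space_closed xiP R_closed.
exists (linfun proj_rep_ext); split.
- move=> x y xR yR; rewrite !lfunE /= => /eqP.
  rewrite -subr_eq0 -raddfB => /eqP fxy; apply/eqP; rewrite -subr_eq0.
  by apply/eqP/proj_rep_ext_inj; rewrite ?rpredB.
- apply/eqP; rewrite eqEdim subvf limg_dim_eq.
    by rewrite dim_jordan_space cardR dimvf dim_matrix leqnn.
  apply/eqP; rewrite -subv0; apply/subvP=> x.
  rewrite memv_cap memv_ker lfunE memv0.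
  by case/andP=> xR /eqP/(proj_rep_ext_inj xR)->.
- move=> x y _ _; rewrite !lfunE /= /jordan_prod linearZ raddfD /=.
  by rewrite !proj_rep_extM.
Qed.

End ProjectiveRepresentation.

(** * Vectors over the field of two elements *)

Lemma F2_cases (x : 'F_2) : x = 0 \/ x = 1.
Proof. by case: x => [[|[|]]] // ?; [left | right]; apply: val_inj. Qed.

Lemma F2_sqr (x : 'F_2) : x ^+ 2 = x.
Proof. by case: (F2_cases x) => ->; rewrite ?expr0n ?expr1n. Qed.

Lemma addr_F2 (x : 'F_2) : x + x = 0.
Proof. by rewrite -[X in X + _]oppr_F2 addNr. Qed.

Lemma oppr_row_F2 n (v : Z2pow n) : - v = v.
Proof. by apply/rowP=> i; rewrite mxE oppr_F2. Qed.

Lemma oppr_set_F2 n (R : {set Z2pow n}) : [set - a | a in R] = R.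
Proof.
by rewrite (eq_imset (g := id)) ?imset_id // => a; apply: oppr_row_F2.
Qed.

Lemma card_row_F2 n : #|'rV['F_2]_n| = (2 ^ n)%N.
Proof. by rewrite card_mx mul1n card_Fp. Qed.

(** * Pauli matrices *)

Section PauliMatrices.
Variables (F : fieldType) (k n : nat) (e : 'I_n -> 'rV['F_2]_k).
Hypothesis e_bij : bijective e.
Implicit Types v w : Z2pow (2 * k).

Definition odd_part v : 'rV['F_2]_k := \row_i v 0 (odd_coord i).

Definition even_dot v (x : 'rV['F_2]_k) : 'F_2 :=
  \sum_(i < k) v 0 (even_coord i) * x 0 i.

(** A bilinear, non symmetric form with bar_form as its alternation and, on the
diagonal, the quadratic form h without its last term. *)
Definition half_form v w : 'F_2 := even_dot w (odd_part v).

Definition pauli_mx v : 'M[F]_n :=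
  monomial_mx e (fun x => sign_form F (even_dot v x)) (fun x => x + odd_part v).

Lemma odd_partD v w : odd_part (v + w) = odd_part v + odd_part w.
Proof. by apply/rowP=> i; rewrite !mxE. Qed.

Lemma even_dotDl v w x : even_dot (v + w) x = even_dot v x + even_dot w x.
Proof.
by rewrite -big_split; apply: eq_bigr => i _; rewrite mxE mulrDl.
Qed.

Lemma even_dotDr v x y : even_dot v (x + y) = even_dot v x + even_dot v y.
Proof.
by rewrite -big_split; apply: eq_bigr => i _; rewrite mxE mulrDr.
Qed.

Lemma half_formDl u v w : half_form (u + v) w = half_form u w + half_form v w.
Proof. by rewrite /half_form odd_partD even_dotDr. Qed.

Lemma half_formDr u v w : half_form u (v + w) = half_form u v + half_form u w.
Proof. exact: even_dotDl. Qed.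

Lemma bar_form_half v w : bar_form v w = half_form w v - half_form v w.
Proof.
by rewrite -sumrB; apply: eq_bigr => i _; rewrite !mxE [X in _ - X]mulrC.
Qed.

Lemma pauli_mxM v w :
  pauli_mx v *m pauli_mx w = sign_form F (half_form v w) *: pauli_mx (v + w).
Proof.
rewrite monomial_mxM // -monomial_mxZ; apply: eq_monomial_mx => x /=.
  rewrite -!sign_formD even_dotDr even_dotDl /half_form; congr (sign_form F _).
  by ring.
by rewrite odd_partD addrA.
Qed.

Lemma pauli_mx0 : pauli_mx 0 = 1%:M.
Proof.
rewrite -(monomial_mx_scalar e_bij); apply: eq_monomial_mx => x.
  by rewrite /even_dot big1 // => i _; rewrite mxE mul0r.
by rewrite -[RHS]addr0; congr (_ + _); apply/rowP=> i; rewrite !mxE.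
Qed.

End PauliMatrices.

(** * Projective representations for the polar bicharacter *)

Section PolarCocycle.
Variables (F : fieldType) (k : nat).
Implicit Types a b : Z2pow (2 * k + 1).

Definition polar_cocycle a b : F :=
  sign_form F (half_form (lsubmx a) (lsubmx b)).

Lemma sign_form_neq0 x : sign_form F x != 0.
Proof. by rewrite signr_eq0. Qed.

Lemma sign_formV x : (sign_form F x)^-1 = sign_form F x.
Proof. exact: invr_sign. Qed.

Lemma polar_cocycleP : cocycle_of (polar_bichar F k) polar_cocycle.
Proof.
split=> [|a b]; last first.
  rewrite sign_formV -sign_formD /= polar_formE bar_form_half oppr_F2.
  by rewrite addrC.
split=> [a b|a b c]; first exact: sign_form_neq0.
by rewrite -!sign_formD !raddfD half_formDl half_formDr; congr sign_form; ring.
Qed.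

End PolarCocycle.

(** xi and the standard cocycle have the same commutation factor, so their
quotient is symmetric, hence the coboundary of some l; the Pauli matrices
rescaled by l multiply according to xi. *)
Lemma exists_proj_rep (F : closedFieldType) (k : nat) xi :
    [pchar F] =i pred0 -> cocycle_of (polar_bichar F k) xi ->
  exists X : Z2pow (2 * k + 1) -> 'M[F]_(2 ^ k),
    (forall a b, X a *m X b = xi a b *: X (a + b)) /\ \tr (X 0) != 0.
Proof.
move=> charF0 [[xi_neq0 xiC] xi_beta].
have [[sg_neq0 sgC] sg_beta] := polar_cocycleP F k.
set sg := @polar_cocycle F k in sg_neq0 sgC sg_beta.
have [||l l_neq0 lM] :=
  @symmetric_cocycle_coboundary F _ (fun a b => xi a b / sg a b).
- split=> [a b|a b c]; first by rewrite mulf_neq0 ?invr_neq0.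
  by rewrite !mulf_div xiC sgC.
- move=> a b; have := xi_beta a b; rewrite -sg_beta => /eqP.
  rewrite !eqr_div // => /eqP xi_sg; apply/eqP; rewrite eqr_div //.
  by rewrite xi_sg mulrC.
have [e e_bij] := enumerate_bij (card_row_F2 k).
exists (fun a => l a *: pauli_mx F e (lsubmx a)); split=> [a b|].
  rewrite -scalemxAl -scalemxAr pauli_mxM // !scalerA lM -raddfD.
  by rewrite mulrAC mulfVK.
rewrite raddf0 pauli_mx0 // mxtraceZ mxtrace1 mulf_neq0 //.
by move/pcharf0P: charF0 => ->; rewrite expn_eq0.
Qed.

(** * The radical and the lift of Z_2^2k to R+ *)

Section RplusStructure.
Variable k : nat.
Implicit Types (v : Z2pow (2 * k)) (a : Z2pow (2 * k + 1)).

Lemma coord_cases (j : 'I_(2 * k)) :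
  (exists i : 'I_k, j = odd_coord i) \/ (exists i : 'I_k, j = even_coord i).
Proof.
have lt_j2 : (j./2 < k)%N by rewrite ltn_half_double -mul2n.
have := odd_double_half j; case: odd => /= def_j; [right | left];
  by exists (Ordinal lt_j2); apply: val_inj; rewrite /= [(2 * j./2)%N]mul2n.
Qed.

(** Pairing v with a basis vector returns the partner coordinate of v. *)
Lemma bar_form_nondegenerate v : (forall w, bar_form v w = 0) -> v = 0.
Proof.
have coord_inj : injective (@odd_coord k) /\ injective (@even_coord k).
  by split=> i j /(congr1 val)/= /eqP; rewrite ?eqSS eqn_mul2l => /eqP/val_inj.
have even_neq_odd (i j : 'I_k) : (even_coord i == odd_coord j) = false.
  by apply/eqP=> /(congr1 (odd \o val))/=; rewrite !mul2n !odd_double.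
move=> v0; apply/rowP=> j; rewrite mxE.
case: (coord_cases j) => -[i ->].
  have := v0 (delta_mx 0 (even_coord i)); rewrite /bar_form (bigD1 i) //= big1.
    by rewrite !mxE !eqxx eq_sym even_neq_odd mulr0 mulr1 add0r addr0 oppr_F2.
  move=> l l_i; rewrite !mxE eq_sym even_neq_odd mulr0 (inj_eq coord_inj.2).
  by rewrite (negPf l_i) mulr0 subr0.
have := v0 (delta_mx 0 (odd_coord i)); rewrite /bar_form (bigD1 i) //= big1.
  by rewrite !mxE !eqxx even_neq_odd mulr0 mulr1 subr0 addr0.
move=> l l_i; rewrite !mxE even_neq_odd mulr0 (inj_eq coord_inj.1).
by rewrite (negPf l_i) mulr0 subr0.
Qed.

Definition Rplus_lift v : Z2pow (2 * k + 1) :=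
  row_mx v (const_mx (half_form v v)).

Lemma last_coordE a : a 0 (last_coord k) = rsubmx a 0 0.
Proof. by rewrite mxE. Qed.

Lemma quad_formE a :
  quad_form a = half_form (lsubmx a) (lsubmx a) + rsubmx a 0 0.
Proof.
rewrite /quad_form F2_sqr last_coordE; congr (_ + _).
by apply: eq_bigr => i _; rewrite !mxE mulrC.
Qed.

Lemma eq_hsubmx a b :
  lsubmx a = lsubmx b -> rsubmx a 0 0 = rsubmx b 0 0 -> a = b.
Proof.
move=> ab_l ab_r; rewrite -[a]hsubmxK -[b]hsubmxK ab_l; congr row_mx.
by apply/matrixP=> i j; rewrite (ord1 i) (ord1 j).
Qed.

Lemma lsubmx_e_last : lsubmx (e_last k) = 0.
Proof. by apply/matrixP=> i j; rewrite !mxE eq_lrshift andbF. Qed.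

Lemma rsubmx_e_last : rsubmx (e_last k) 0 0 = 1.
Proof. by rewrite !mxE !eqxx. Qed.

Lemma quad_formD a b :
  quad_form (a + b) = polar_form a b + quad_form a + quad_form b.
Proof. by rewrite /polar_form; ring. Qed.

Lemma quad_formD_last a : quad_form (a + e_last k) = quad_form a + 1.
Proof.
by rewrite !quad_formE !raddfD /= lsubmx_e_last addr0 mxE rsubmx_e_last addrA.
Qed.

Lemma Rplus_liftK : cancel Rplus_lift lsubmx.
Proof. by move=> v; rewrite row_mxKl. Qed.

Lemma Rplus_lift_in v : Rplus_lift v \in Rplus k.
Proof.
rewrite inE quad_formE Rplus_liftK row_mxKr mxE.
exact/eqP/addr_F2.
Qed.

Lemma Rplus_lift_lsubmx : {in Rplus k, cancel lsubmx Rplus_lift}.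
Proof.
move=> a; rewrite inE quad_formE addr_eq0 oppr_F2 => /eqP def_a.
by apply: eq_hsubmx; rewrite ?Rplus_liftK // row_mxKr mxE.
Qed.

Lemma card_Rplus : #|Rplus k| = (2 ^ (2 * k))%N.
Proof.
have -> : Rplus k = [set Rplus_lift v | v : Z2pow (2 * k)].
  apply/setP=> a; apply/idP/imsetP=> [aR|[v _ ->]]; last exact: Rplus_lift_in.
  by exists (lsubmx a); rewrite ?Rplus_lift_lsubmx.
by rewrite card_imset ?card_row_F2 //; apply: can_inj Rplus_liftK.
Qed.

Lemma lsubmx_eq0 a : (lsubmx a == 0) = (a \in [set 0; e_last k]).
Proof.
rewrite !inE; apply/eqP/orP=> [a0|[]/eqP->]; last 2 first.
- exact: raddf0.
- exact: lsubmx_e_last.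
case: (F2_cases (rsubmx a 0 0)) => a_last; [left | right]; apply/eqP.
  by apply: eq_hsubmx; rewrite raddf0 // a_last mxE.
by apply: eq_hsubmx; rewrite ?lsubmx_e_last ?rsubmx_e_last.
Qed.

End RplusStructure.

(** * Signs away from characteristic 2 *)

Section CharacteristicNot2.
Variables (F : fieldType) (two_neq0 : 2%:R != 0 :> F).

Lemma oppr1_neq1 : (-1 == 1 :> F) = false.
Proof. by rewrite eq_sym -subr_eq0 opprK -mulr2n (negPf two_neq0). Qed.

Lemma sign_form_eq1 x : (sign_form F x == 1) = (x == 0).
Proof.
by case: (F2_cases x) => ->; rewrite /sign_form ?expr0 ?expr1 ?eqxx ?oppr1_neq1.
Qed.

Lemma sign_form_eqN1 x : (sign_form F x == -1) = (x == 1).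
Proof.
case: (F2_cases x) => ->; rewrite /sign_form ?expr0 ?expr1 ?eqxx //.
by rewrite eq_sym oppr1_neq1.
Qed.

(** The root 0 is joined to all the others, since beta(0, a) = 1 <> -1. *)
Lemma indecomposable_with0 (G : finZmodType) (beta : alt_bicharacter F G)
    (R : {set G}) :
  0 \in R -> indecomposable beta R.
Proof.
move=> R0.
have to0 (a : G) : a \in R ->
    connect (srs_edge beta R) a 0 /\ connect (srs_edge beta R) 0 a.
  move=> aR; have [->|a0] := eqVneq a 0; first by rewrite !connect0.
  split; apply: connect1; rewrite /srs_edge aR R0 /= ?[0 == _]eq_sym a0.
    by rewrite bicharC bichar0l invr1 eq_sym oppr1_neq1.
  by rewrite bichar0l eq_sym oppr1_neq1.
by move=> a b /to0[a0 _] /to0[_ b0]; apply: connect_trans a0 b0.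
Qed.

End CharacteristicNot2.

(** * The skew root system R+ *)

Section RplusRootSystem.
Variables (F : fieldType) (two_neq0 : 2%:R != 0 :> F) (k : nat).
Implicit Types (v w : Z2pow (2 * k)) (a b : Z2pow (2 * k + 1)).

Let beta := polar_bichar F k.

Lemma bar_rad : nonsingular (bar_bichar F k).
Proof.
apply/setP=> v; rewrite in_set1; apply/in_bichar_radP/eqP=> [v0|-> w].
  apply: bar_form_nondegenerate => w; apply/eqP.
  by rewrite -(sign_form_eq1 two_neq0); apply/eqP/v0.
exact: bichar0l.
Qed.

Lemma in_polar_rad a : (a \in bichar_rad beta) = (lsubmx a == 0).
Proof.
have -> : (lsubmx a == 0) = (lsubmx a \in bichar_rad (bar_bichar F k)).
  by rewrite bar_rad in_set1.
apply/in_bichar_radP/in_bichar_radP => [a0 w|a0 b].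
  by have := a0 (Rplus_lift w); rewrite /= polar_formE Rplus_liftK.
by have := a0 (lsubmx b); rewrite /= polar_formE.
Qed.

(** For a, b in R+, h(a + b) is the polar form of a and b, and it vanishes
unless beta(a, b) = -1. *)
Lemma Rplus_closed :
  {in Rplus k &, forall a b, beta a b != -1 -> a + b \in Rplus k}.
Proof.
move=> a b; rewrite !inE /= (sign_form_eqN1 two_neq0) quad_formD.
move=> /eqP-> /eqP->.
by case: (F2_cases (polar_form a b)) => ->; rewrite ?eqxx ?addr0.
Qed.

Lemma Rplus_inj :
  {in Rplus k &, forall a b, a - b \in bichar_rad beta -> a = b}.
Proof.
move=> a b aR bR; rewrite in_polar_rad raddfB subr_eq0 => /eqP ab.
by rewrite -(Rplus_lift_lsubmx aR) ab Rplus_lift_lsubmx.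
Qed.

(** Take c = a + b with a, b in R+ and polar form 1, so h(c) = 1. Adding e_last
switches h, so c + e_last is in R+, and with it e_last is in the subgroup
generated by R+. Any element outside R+ is then a root plus e_last. *)
Lemma gen_Rplus : (0 < k)%N -> <<Rplus k>>%g = [set: Z2pow (2 * k + 1)].
Proof.
move=> k_gt0.
have genD (a b : Z2pow (2 * k + 1)) :
    a \in <<Rplus k>>%g -> b \in <<Rplus k>>%g -> a + b \in <<Rplus k>>%g.
  exact: groupM.
have [v [w vw]] : exists v w : Z2pow (2 * k), bar_form v w != 0.
  pose v : Z2pow (2 * k) := delta_mx 0 (odd_coord (Ordinal k_gt0)).
  have [/existsP[w vw]|/existsPn v0] := boolP [exists w, bar_form v w != 0].
    by exists v, w.
  suff: v = 0.
    by move/rowP/(_ (odd_coord (Ordinal k_gt0)))/eqP; rewrite !mxE !eqxx.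
  by apply: bar_form_nondegenerate => w; apply/eqP; rewrite -[_ == _]negbK.
pose c := Rplus_lift v + Rplus_lift w.
have c_gen : c \in <<Rplus k>>%g by apply: genD; apply/mem_gen/Rplus_lift_in.
have q_c : quad_form c = 1.
  have := Rplus_lift_in v; have := Rplus_lift_in w.
  rewrite !inE => /eqP qw /eqP qv.
  rewrite quad_formD qw qv !addr0 polar_formE !Rplus_liftK.
  by case: (F2_cases (bar_form v w)) vw => ->; rewrite ?eqxx.
have shift_gen a : quad_form a = 1 -> a + e_last k \in <<Rplus k>>%g.
  move=> q_a; apply: mem_gen; rewrite inE quad_formD_last q_a.
  by rewrite addr_F2.
have e_gen : e_last k \in <<Rplus k>>%g.
  rewrite -[e_last k](addKr c) oppr_row_F2.
  by apply: genD => //; apply: shift_gen.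
apply/setP=> a; rewrite inE; case: (F2_cases (quad_form a)) => q_a.
  by apply: mem_gen; rewrite inE q_a.
rewrite -[a](addrK (e_last k)) oppr_row_F2; apply: genD => //.
exact: shift_gen.
Qed.

Lemma Rplus_srs : (0 < k)%N -> skew_root_system beta (Rplus k).
Proof.
move=> k_gt0; split.
- by apply/set0Pn; exists (Rplus_lift 0); apply: Rplus_lift_in.
- exact: gen_Rplus.
- exact: oppr_set_F2.
- exact: Rplus_closed.
Qed.

Lemma setT_srs : skew_root_system (bar_bichar F k) [set: Z2pow (2 * k)].
Proof.
split.
- by apply/set0Pn; exists 0; rewrite inE.
- by apply/eqP; rewrite eqEsubset subsetT subset_gen.
- exact: oppr_set_F2.
- by move=> a b _ _ _; rewrite inE.
Qed.

Lemma pi_quo_eq a b :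
  (\pi_(quo beta) a == \pi_(quo beta) b) = (lsubmx a == lsubmx b).
Proof.
by rewrite -Quotient.idealrBE unfold_in in_polar_rad raddfB subr_eq0.
Qed.

Lemma Rplus_reduction :
  exists phi : quo beta -> Z2pow (2 * k),
    (forall a, phi (\pi_(quo beta) a) = lsubmx a) /\
    srs_iso (quo_bichar beta) (quo_roots beta (Rplus k))
            (bar_bichar F k) [set: Z2pow (2 * k)] phi.
Proof.
pose phi (x : quo beta) : Z2pow (2 * k) := lsubmx (generic_quotient.repr x).
have phi_pi a : phi (\pi_(quo beta) a) = lsubmx a.
  by apply/eqP; rewrite -pi_quo_eq reprK.
exists phi; split=> //; split=> [x y||x y|].
- by rewrite -[x]reprK -[y]reprK -raddfD !phi_pi raddfD.
- exists (fun v => \pi_(quo beta) (Rplus_lift v)) => [x|v].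
    by apply/eqP; rewrite -[x]reprK phi_pi pi_quo_eq Rplus_liftK.
  by rewrite phi_pi Rplus_liftK.
- by rewrite -[x]reprK -[y]reprK !phi_pi [RHS]quo_formE /= polar_formE.
- apply/setP=> v; rewrite inE; apply/imsetP.
  exists (\pi_(quo beta) (Rplus_lift v)).
    by apply/imsetP; exists (Rplus_lift v); first exact: Rplus_lift_in.
  by rewrite phi_pi Rplus_liftK.
Qed.

End RplusRootSystem.

Theorem proposition5p8 (F : closedFieldType) (charF0 : [pchar F] =i pred0)
    (k : nat) (k_gt0 : (1 <= k)%N) :
  let beta := polar_bichar F k in
  let beta_bar := bar_bichar F k in
  let R := Rplus k in
  [/\ bichar_rad beta = [set 0; e_last k],
      skew_root_system beta R
    & [/\ exists phi : quo beta -> Z2pow (2 * k),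
            (forall a : Z2pow (2 * k + 1), phi (\pi_(quo beta) a) = lsubmx a) /\
            srs_iso (quo_bichar beta) (quo_roots beta R)
                    beta_bar [set: Z2pow (2 * k)] phi,
          nonsingular beta_bar
            /\ skew_root_system beta_bar [set: Z2pow (2 * k)],
          ~ reduced beta R /\ indecomposable beta R,
          #|R| = (2 ^ (2 * k))%N
        & (exists xi, cocycle_of beta xi) /\
          forall xi, cocycle_of beta xi ->
            subalg_isomorphic (jordan_prod (twmul xi)) (jordan_space F R)
              (jordan_prod (@mulmx F (2 ^ k) (2 ^ k) (2 ^ k)))]].
Proof.
move=> beta beta_bar R.
have two_neq0 : 2%:R != 0 :> F by move/pcharf0P: charF0 => ->.
have radE : bichar_rad beta = [set 0; e_last k].
  by apply/setP=> a; rewrite (in_polar_rad two_neq0) lsubmx_eq0.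
split; [exact: radE | exact: Rplus_srs | split].
- exact: Rplus_reduction.
- by split; [apply: bar_rad | apply: setT_srs].
- split; last first.
    apply: indecomposable_with0 => //; rewrite inE quad_formE !raddf0 mxE addr0.
    by rewrite /half_form /even_dot big1 // => i _; rewrite mxE mul0r.
  rewrite /reduced /nonsingular radE => /setP/(_ (e_last k)).
  rewrite !inE eqxx orbT => /esym/eqP/matrixP/(_ 0 (last_coord k))/eqP.
  by rewrite !mxE !eqxx.
- exact: card_Rplus.
- split=> [|xi xiP].
    by exists (@polar_cocycle F k); apply: polar_cocycleP.
  have [X [XM trX0]] := exists_proj_rep charF0 xiP.
  apply: (jordan_space_iso_matrix xiP XM trX0).
  + exact: Rplus_closed.
  + exact: Rplus_inj.
  + by rewrite card_Rplus -expnD addnn mul2n.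
Qed.
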